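(* Let $A\in\mathbb{R}^{n\times n}$, $B\in\mathbb{R}^{n\times m}$, and let $\mathcal{A}\in\{0,*\}^{n\times n}$, $\mathcal{B}\in\{0,*\}^{n\times m}$ be pattern matrices. The following statements are equivalent: 1) The perturbed system is structurally controllable, i.e. there exist $\Delta A\in[\mathcal{A}]$ and $\Delta B\in[\mathcal{B}]$ such that $(A+\Delta A,B+\Delta B)$ is controllable. 2) (a) For each eigenvalue $\lambda_i\in\sigma(A)$, $$\max_{\Delta A\in[\mathcal{A}],\,\Delta B\in[\mathcal{B}]}\operatorname{rank}[\lambda_i I-A-\Delta A,\;B+\Delta B]=n;$$ and (b) every edge $e\in E_{xz}$ of the auxiliary connection digraph $\mathcal{G}_{\rm auc}$ is input-reachable. 3) (a) For each $\lambda_i\in\sigma(A)$, the intersection of the column matroid of the $n\times(2n+m)$ matrix $[I_n,\ \lambda_i I-A,\ B]$ and the column matroid of the $(n+m)\times(2n+m)$ matrix $[[\mathcal{A},\mathcal{B}]^\intercal,\ \bar I_{n+m}]$ (both on the ground set $[2n+m]$) has cardinality $n$; and (b) every vertex $z_i\in V_z$ is input-reachable in $\mathcal{G}_{\rm auc}$.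
   Context: A pattern matrix is a matrix with entries in $\{0,*\}$. For $\mathcal{M}\in\{0,*\}^{n_1\times n_2}$, $[\mathcal{M}]=\{M\in\mathbb{R}^{n_1\times n_2}: M_{ij}=0 \text{ whenever } \mathcal{M}_{ij}=0\}$. The generic rank $\operatorname{grank}\mathcal{M}$ is the maximum rank of an element of $[\mathcal{M}]$. $\bar I_k$ denotes the $k\times k$ diagonal pattern matrix with all diagonal entries $*$. Controllability of $(A,B)$ means the controllability matrix $[B,AB,\dots,A^{n-1}B]$ has rank $n$; $\sigma(A)$ is the set of (complex) eigenvalues of $A$, and ranks with complex $\lambda_i$ are over $\mathbb{C}$. For a matrix $W$ with $q$ columns (possibly containing pattern/free entries), its column matroid is $([q],\mathcal{I}_W)$ with $\mathcal{I}_W=\{I\subseteq[q]: \operatorname{rank}W(:,I)=|I|\}$ (using generic rank when $W$ contains $*$ entries, treating the $*$ entries as independent free parameters). The cardinality of the intersection of two matroids on the same ground set is the maximum size of a set independent in both. Auxiliary connection digraph (ACG) $\mathcal{G}_{\rm auc}$: define the rational matrices $G_{zx}(\lambda)=\begin{bmatrix}(\lambda I-A)^{-1}\\ 0_{m\times n}\end{bmatrix}$ and $G_{zu}(\lambda)=\begin{bmatrix}(\lambda I-A)^{-1}B\\ I_m\end{bmatrix}$ (both $(n+m)$-row). Vertex set $V_z\cup V_x\cup V_u$ with $V_z=\{z_1,\dots,z_{n+m}\}$, $V_x=\{x_1,\dots,x_n\}$, $V_u=\{u_1,\dots,u_m\}$. Edge set $E_{xz}\cup E_{uz}\cup E_{zx}$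 where $E_{xz}=\{(x_j,z_i): [G_{zx}(\lambda)]_{ij}\not\equiv 0\}$, $E_{uz}=\{(u_j,z_i):[G_{zu}(\lambda)]_{ij}\not\equiv0\}$, $E_{zx}=\{(z_i,x_j): [\mathcal{A},\mathcal{B}]_{ji}=*\}$. A vertex is input-reachable if there is a directed path from some vertex of $V_u$ ending at it; an edge in $E_{xz}$ is input-reachable if its start or end vertex is input-reachable. *)

(* Defs.v *)
From HB Require Import structures.
From mathcomp Require Import all_boot all_order all_algebra.
From mathcomp Require Import complex.
From mathcomp Require Import reals.
Set Implicit Arguments. Unset Strict Implicit. Unset Printing Implicit Defensive.
Import Order.TTheory GRing.Theory Num.Theory.
Local Open Scope ring_scope.

(* Pattern matrices: entries in {0,*}, encoded as booleans (true = *, false = 0). *)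
Definition pattern (p q : nat) := 'M[bool]_(p, q).

Definition fits (R : realType) p q (P : pattern p q) (M : 'M[R]_(p, q)) : Prop :=
  forall i j, P i j = false -> M i j = 0.

Definition cmx (R : realType) p q (M : 'M[R]_(p, q)) : 'M[R[i]]_(p, q) :=
  map_mx (fun x => x%:C%C) M.

Definition ctrb_mx (R : realType) n m (A : 'M[R]_n) (B : 'M[R]_(n, m))
  : 'M[R]_(n, \sum_(k < n) m) := \mxrow_(k < n) (A ^+ k *m B).

Definition controllable (R : realType) n m (A : 'M[R]_n) (B : 'M[R]_(n, m)) : Prop :=
  \rank (ctrb_mx A B) = n.

Definition spectrum (R : realType) n (A : 'M[R]_n) (l : R[i]) : bool :=
  eigenvalue (cmx A) l.

Definition colsubset (F : Type) p q (W : 'M[F]_(p, q)) (I : {set 'I_q}) : 'M[F]_(p, #|I|) :=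
  colsub (fun k : 'I_#|I| => enum_val k) W.

Definition indep_num (F : fieldType) p q (W : 'M[F]_(p, q)) (I : {set 'I_q}) : Prop :=
  \rank (colsubset W I) = #|I|.

Definition grank_is (R : realType) p q (P : pattern p q) (r : nat) : Prop :=
  (exists M : 'M[R]_(p, q), fits P M /\ \rank M = r) /\
  (forall M : 'M[R]_(p, q), fits P M -> (\rank M <= r)%N).

Definition indep_pat (R : realType) p q (P : pattern p q) (I : {set 'I_q}) : Prop :=
  grank_is R (colsubset P I) #|I|.

Definition matroid_inter_card q (ind1 ind2 : {set 'I_q} -> Prop) (k : nat) : Prop :=
  (exists I, ind1 I /\ ind2 I /\ #|I| = k) /\
  (forall I, ind1 I -> ind2 I -> (#|I| <= k)%N).

Definition W2_pat n m (PA : pattern n n) (PB : pattern n m) : pattern (n + m) (n + (n + m)) :=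
  row_mx (row_mx PA PB)^T (\matrix_(i, j) (i == j)).

Definition W1_mx (R : realType) n m (A : 'M[R]_n) (B : 'M[R]_(n, m)) (l : R[i])
  : 'M[R[i]]_(n, n + (n + m)) :=
  row_mx 1%:M (row_mx (l%:M - cmx A) (cmx B)).

Definition ratR (R : realType) := {fraction {poly R}}.

Definition rat_const (R : realType) (x : R) : ratR R := tofrac (x%:P).

Definition charF (R : realType) n (A : 'M[R]_n) : 'M[ratR R]_n :=
  map_mx (fun p : {poly R} => tofrac p) (char_poly_mx A).

Definition Gzx (R : realType) n m (A : 'M[R]_n) : 'M[ratR R]_(n + m, n) :=
  col_mx (invmx (charF A)) 0.

Definition Gzu (R : realType) n m (A : 'M[R]_n) (B : 'M[R]_(n, m)) : 'M[ratR R]_(n + m, m) :=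
  col_mx (invmx (charF A) *m map_mx (@rat_const R) B) 1%:M.

Definition acg_vertex n m : finType := ('I_(n + m) + ('I_n + 'I_m))%type.
Definition vz n m (i : 'I_(n + m)) : acg_vertex n m := inl i.
Definition vx n m (j : 'I_n) : acg_vertex n m := inr (inl j).
Definition vu n m (j : 'I_m) : acg_vertex n m := inr (inr j).

Definition acg_edge (R : realType) n m (A : 'M[R]_n) (B : 'M[R]_(n, m))
  (PA : pattern n n) (PB : pattern n m) : rel (acg_vertex n m) :=
  fun a b =>
    match a, b with
    | inr (inl j), inl i => Gzx m A i j != 0
    | inr (inr j), inl i => Gzu A B i j != 0
    | inl i, inr (inl j) => row_mx PA PB j i
    | _, _ => false
    end.

Definition input_reachable (R : realType) n m (A : 'M[R]_n) (B : 'M[R]_(n, m))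
  (PA : pattern n n) (PB : pattern n m) (v : acg_vertex n m) : Prop :=
  exists j : 'I_m, connect (acg_edge A B PA PB) (@vu n m j) v.

Definition pencil_maxrank_is (R : realType) n m (A : 'M[R]_n) (B : 'M[R]_(n, m))
  (PA : pattern n n) (PB : pattern n m) (l : R[i]) (r : nat) : Prop :=
  (exists (dA : 'M[R]_n) (dB : 'M[R]_(n, m)), fits PA dA /\ fits PB dB /\
     \rank (row_mx (l%:M - cmx (A + dA)) (cmx (B + dB))) = r) /\
  (forall (dA : 'M[R]_n) (dB : 'M[R]_(n, m)), fits PA dA -> fits PB dB ->
     (\rank (row_mx (l%:M - cmx (A + dA)) (cmx (B + dB))) <= r)%N).

(* Main.v *)
Require Import Defs.
From HB Require Import structures.
From mathcomp Require Import all_boot all_order all_algebra.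
From mathcomp Require Import perm.
From mathcomp Require Import complex.
From mathcomp Require Import reals.
From mathcomp Require Import boolp.
Import Order.TTheory GRing.Theory Num.Theory.
Local Open Scope ring_scope.
Set Implicit Arguments. Unset Strict Implicit. Unset Printing Implicit Defensive.

(** Write C = [A + dA, B + dB] and call l a mode if [l I - A - dA, B + dB] is
    not of full row rank; by the Hautus test one must reach a perturbation
    without modes.  Suppose z_j has a nonzero transfer function from the inputs.
    Changing the entry (i, j) of C by t is a rank one update, and a left kernel
    vector of the updated pencil at a mode l outside the spectrum is, up to
    scaling, row j of the resolvent at l; hence the transfer function to z_j
    vanishes at l, and the modes occurring for any t at all lie in one finite
    set.  So for all but finitely many t no mode outside a prescribed finite set
    appears.  Starting from a perturbation for which every z_j is reached, one
    moves in this way, entry by entry, to a perturbation avoiding the remaining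
    finitely many modes, each of which can be avoided separately.

    Necessity of input-reachability: the rows e_l A^k with z_l not reachable
    span a space that is invariant under A + dA and annihilated by B + dB.

    The matroid condition is a matching: expanding the minors of
    [l I - A - dA, B + dB] = [I, N] [D; I] multilinearly in the columns gives
    columns f of [I, N] of full rank matched to the columns g of the minor, and
    conversely large free entries placed on the matching give a nonzero minor. *)

(** * Properties of all but finitely many scalars *)

Section Cofinite.
Variable R : numDomainType.
Implicit Types P Q : R -> Prop.

Definition cofin P := exists s : seq R, forall t, t \notin s -> P t.

Lemma cofinI P Q : cofin P -> cofin Q -> cofin (fun t => P t /\ Q t).
Proof.
move=> [s sP] [s' s'Q]; exists (s ++ s') => t.
by rewrite mem_cat negb_or => /andP[/sP ? /s'Q].
Qed.

Lemma sub_cofin P Q : (forall t, P t -> Q t) -> cofin P -> cofin Q.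
Proof. by move=> PQ [s sP]; exists s => t /sP/PQ. Qed.

Lemma cofin_ex P : cofin P -> exists t, P t.
Proof.
case=> s sP; suff [k ks] : exists k : nat, k%:R \notin s by exists k%:R; apply: sP.
apply: contrapT => all_in.
have sub : {subset [seq k%:R | k <- iota 0 (size s).+1] <= s}.
  move=> _ /mapP[k _ ->]; apply/negPn/negP => ks.
  by apply: all_in; exists k.
have un : uniq [seq (k%:R : R) | k <- iota 0 (size s).+1].
  by rewrite map_inj_uniq ?iota_uniq //; apply: mulrIn; rewrite oner_neq0.
by have := uniq_leq_size un sub; rewrite size_map size_iota ltnn.
Qed.

Lemma cofin_neq a : cofin (fun t => t != a).
Proof. by exists [:: a] => t; rewrite inE. Qed.

Lemma cofin_shift P a : cofin P -> cofin (fun t => P (t + a)).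
Proof.
case=> s sP; exists [seq t - a | t <- s] => t ts; apply: sP.
by apply: contra ts => ts; apply/mapP; exists (t + a); rewrite ?addrK.
Qed.

Lemma cofin_seq (T : eqType) (r : seq T) (P : T -> R -> Prop) :
  (forall x, x \in r -> cofin (P x)) -> cofin (fun t => forall x, x \in r -> P x t).
Proof.
elim: r => [|y r IHr] Pr; first by exists [::] => t _ x; rewrite in_nil.
have Py := Pr y (mem_head y r).
have /IHr Pt : forall x, x \in r -> cofin (P x).
  by move=> x xr; apply: Pr; rewrite inE xr orbT.
apply: sub_cofin (cofinI Py Pt) => t [Pyt Prt] x.
by rewrite inE => /predU1P[->|/Prt].
Qed.

Lemma cofin_fin (T : finType) (P : T -> R -> Prop) :
  (forall x, cofin (P x)) -> cofin (fun t => forall x, P x t).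
Proof.
move=> Px; have /(_ _)/sub_cofin := @cofin_seq _ (enum T) P.
by apply=> // t Pt x; apply: Pt; rewrite mem_enum.
Qed.

End Cofinite.

(** Stated over integral domains because coefficients are polynomials in one use and complex numbers
    in another. *)
Lemma finite_roots (D : idomainType) (p : {poly D}) :
  p != 0 -> exists s : seq D, forall x, root p x -> x \in s.
Proof.
have [k] := ubnP (size p); elim: k p => // k IHk p lep p0.
have [[a /factor_theorem[q pE]]|noroot] := pselect (exists a, root p a); last first.
  by exists [::] => x rx; case: noroot; exists x.
have q0 : q != 0 by apply: contraNneq p0 => q0; rewrite pE q0 mul0r.
have [|//|s sP] := IHk q.
  move: lep; rewrite pE size_Mmonic ?monicXsubC // size_XsubC addn2 /= ltnS.
  exact: leq_trans.
exists (a :: s) => x; rewrite pE rootM root_XsubC inE => /orP[/sP->|->//].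
by rewrite orbT.
Qed.

(* Up to the factor \det M, the transfer matrix from the inputs to z = (x, u). *)
Definition resolvent (S : comNzRingType) n m (M : 'M[S]_n) (B : 'M[S]_(n, m)) : 'M[S]_(n + m, m) :=
  col_mx (\adj M *m B) (\det M)%:M.

Lemma map_resolvent (S S' : comNzRingType) (f : {rmorphism S -> S'}) n m
    (M : 'M[S]_n) (B : 'M[S]_(n, m)) :
  map_mx f (resolvent M B) = resolvent (map_mx f M) (map_mx f B).
Proof. by rewrite map_col_mx map_mxM map_mx_adj map_scalar_mx /= -det_map_mx. Qed.

(** * Polynomial conditions along a line of matrices *)

Section CofiniteAlgebra.
Variables (R : realFieldType) (D : idomainType) (iota : {rmorphism R -> D}).

Lemma cofin_horner (p : {poly D}) : p != 0 -> cofin (fun t => p.[iota t] != 0).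
Proof.
move=> /finite_roots[s sP].
(* [h y] lists the at most one [t] with [iota t = y], pulling the roots back to [R]. *)
pose h y : seq R := if pselect (exists t, iota t = y) is left e then [:: projT1 (cid e)] else [::].
exists (flatten (map h s)) => t; apply: contra => pt0.
apply/flattenP; exists (h (iota t)); first by apply: map_f; apply: sP.
rewrite /h; case: pselect => [e|[]]; last by exists t.
by case: cid => u /= /fmorph_inj->; rewrite inE.
Qed.

(** Keeps the parameter as an indeterminate: determinants along the line become polynomials, nonzero
    as soon as they do not vanish at 0. *)
Definition line p q (N0 N1 : 'M[D]_(p, q)) : 'M[{poly D}]_(p, q) :=
  map_mx polyC N0 + 'X *: map_mx polyC N1.

Lemma horner_line p q (N0 N1 : 'M[D]_(p, q)) x :
  map_mx (horner_eval x) (line N0 N1) = N0 + x *: N1.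
Proof. by apply/matrixP => i j; rewrite !mxE /horner_eval !hornerE. Qed.

Lemma cofin_det n (N0 N1 : 'M[D]_n) :
  \det N0 != 0 -> cofin (fun t => \det (N0 + iota t *: N1) != 0).
Proof.
move=> N0_neq0; have detE x : (\det (line N0 N1)).[x] = \det (N0 + x *: N1).
  by rewrite -horner_line det_map_mx.
apply: sub_cofin (cofin_horner (p := \det (line N0 N1)) _) => [t|]; first by rewrite detE.
apply: contraNneq N0_neq0 => p0.
by rewrite -[N0]addr0 -(scale0r N1) -detE p0 horner0.
Qed.

Lemma cofin_resolvent n m (M N : 'M[D]_n) (B C : 'M[D]_(n, m)) j k :
  resolvent M B j k != 0 ->
  cofin (fun t => resolvent (M + iota t *: N) (B + iota t *: C) j k != 0).
Proof.
move=> r0; pose p := resolvent (line M N) (line B C) j k.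
have pE x : p.[x] = resolvent (M + x *: N) (B + x *: C) j k.
  rewrite -!horner_line -map_resolvent [RHS]mxE /horner_eval //.
apply: sub_cofin (cofin_horner (p := p) _) => [t|]; first by rewrite pE.
apply: contraNneq r0 => p0.
by rewrite -[M]addr0 -[B]addr0 -(scale0r N) -(scale0r C) -pE p0 horner0.
Qed.

End CofiniteAlgebra.

(** A right inverse [Q] of [N0] reduces full row rank to a determinant, that of
    [(N0 + iota t *: N1) *m Q], which is 1 at [t = 0]. *)
Lemma cofin_row_free (R : realFieldType) (F : fieldType) (iota : {rmorphism R -> F})
    p q (N0 N1 : 'M[F]_(p, q)) :
  row_free N0 -> cofin (fun t => row_free (N0 + iota t *: N1)).
Proof.
move=> /row_freeP[Q N0Q].
have /(cofin_det iota (N1 *m Q)) : \det (N0 *m Q) != 0 by rewrite N0Q det1 oner_neq0.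
apply: sub_cofin => t; rewrite scalemxAl -mulmxDl -unitfE -unitmxE => u.
by apply/row_freeP; exists (Q *m invmx ((N0 + iota t *: N1) *m Q)); rewrite mulmxA mulmxV.
Qed.

(** * The Hautus test *)

Lemma row_free_kerP (F : fieldType) p q (M : 'M[F]_(p, q)) :
  row_free M <-> (forall v : 'rV_p, v *m M = 0 -> v = 0).
Proof.
split=> [/row_free_inj M_inj v vM0|M_inj]; first by apply: M_inj; rewrite mul0mx.
rewrite -kermx_eq0; apply/eqP/row_matrixP => i; rewrite row0.
by apply: M_inj; rewrite -row_mul mulmx_ker row0.
Qed.

(** By Cayley-Hamilton, [A ^+ k] is the value at [A] of the remainder of ['X^k] modulo
    [char_poly A], of degree below [n]. *)
Lemma krylov_eq0 (F : fieldType) n m p (v : 'M[F]_(p, n)) (A : 'M[F]_n) (B : 'M[F]_(n, m)) :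
  (forall k, (k < n)%N -> v *m A ^+ k *m B = 0) -> forall k, v *m A ^+ k *m B = 0.
Proof.
case: n => [|n] in v A B * => vAB k; first by rewrite [v]thinmx0 !mul0mx.
have vB (q : {poly F}) : (size q <= n.+1)%N -> v *m horner_mx A q *m B = 0.
  move=> szq; rewrite -[q]coefK poly_def linear_sum mulmx_sumr mulmx_suml big1 // => i _.
  rewrite linearZ /= rmorphXn /= horner_mx_X -scalemxAr -scalemxAl vAB ?scaler0 //.
  exact: leq_trans (ltn_ord i) szq.
rewrite -[A ^+ k](_ : horner_mx A ('X^k) = _); last by rewrite rmorphXn /= horner_mx_X.
rewrite (divp_eq 'X^k (char_poly A)) rmorphD rmorphM /= Cayley_Hamilton mulr0 add0r.
by apply: vB; rewrite -ltnS -(size_char_poly A) ltn_modp monic_neq0 ?char_poly_monic.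
Qed.

Lemma map_mxrow (S T : Type) (f : S -> T) p k (q : 'I_k -> nat) (M : forall i, 'M[S]_(p, q i)) :
  map_mx f (\mxrow_i M i) = \mxrow_i map_mx f (M i).
Proof. by apply/matrixP => i j; rewrite !mxE. Qed.

Section Controllability.
Variables (R : realType) (n m : nat).
Implicit Types (A : 'M[R]_n) (B : 'M[R]_(n, m)).

Lemma cmxE p q (M : 'M[R]_(p, q)) : cmx M = map_mx (real_complex R) M.
Proof. by []. Qed.

Lemma cmxX A k : cmx (A ^+ k) = cmx A ^+ k.
Proof.
rewrite !cmxE; elim: k => [|k IHk]; first by rewrite !expr0 map_mx1.
by rewrite !exprS -IHk; apply: (map_mxM (real_complex R)).
Qed.

Lemma controllableP A B : controllable A B <->
  (forall v : 'rV[R[i]]_n, (forall k, v *m cmx A ^+ k *m cmx B = 0) -> v = 0).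
Proof.
have -> : controllable A B <-> row_free (cmx (ctrb_mx A B)).
  by rewrite /row_free cmxE mxrank_map; split=> [->|/eqP].
have -> : cmx (ctrb_mx A B) = \mxrow_(k < n) (cmx A ^+ k *m cmx B).
  rewrite cmxE map_mxrow; apply/eq_mxrowP => k.
  by rewrite map_mxM -cmxX.
rewrite row_free_kerP; split=> H v.
  move=> vAB; apply: H; rewrite mul_mxrow -(@mxrow0 _ _ _ 1); apply/eq_mxrowP => k.
  by rewrite mulmxA vAB.
rewrite mul_mxrow -(@mxrow0 _ _ _ 1) => /eq_mxrowP vAB; apply: H.
by apply: krylov_eq0 => k ltkn; have := vAB (Ordinal ltkn); rewrite mulmxA.
Qed.

(** A left kernel vector of the pencil is a left eigenvector of [A] killed by [B], hence by every
    A^k B. Conversely the left kernel of the controllability matrix is stable under [A], so if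
    nonzero it contains an eigenvector. *)
Lemma hautus A B : controllable A B <->
  (forall l : R[i], row_free (row_mx (l%:M - cmx A) (cmx B))).
Proof.
rewrite controllableP; split=> [ctrl l|full v vAB].
  apply/row_free_kerP => v; rewrite mul_mx_row -(row_mx0 _ 1 n m).
  move=> /eq_row_mx[/eqP]; rewrite mulmxBr mul_mx_scalar subr_eq0 => /eqP vA vB.
  apply: ctrl => k; suff -> : v *m cmx A ^+ k = l ^+ k *: v.
    by rewrite -scalemxAl vB scaler0.
  elim: k => [|k IHk]; first by rewrite !expr0 mulmx1 scale1r.
  by rewrite exprSr mulmxA IHk -scalemxAl -vA scalerA -exprSr.
apply/eqP; apply: contraT => v0.
have n_gt0 : (0 < n)%N.
  by case: n v v0 {vAB full A B} => // v; rewrite [v]thinmx0 eqxx.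
pose W := kermx (\mxrow_(k < n) (cmx A ^+ k *m cmx B)).
have WP (w : 'rV_n) : (w <= W)%MS <-> forall k, w *m cmx A ^+ k *m cmx B = 0.
  split=> [/sub_kermxP|wAB].
    rewrite mul_mxrow -(@mxrow0 _ _ _ 1) => /eq_mxrowP wAB.
    by apply: krylov_eq0 => k ltkn; have := wAB (Ordinal ltkn); rewrite mulmxA.
  apply/sub_kermxP; rewrite mul_mxrow -(@mxrow0 _ _ _ 1); apply/eq_mxrowP => k.
  by rewrite mulmxA wAB.
have W_stable : stablemx W (cmx A).
  apply/row_subP => i; rewrite row_mul; apply/WP => k.
  by have /WP/(_ k.+1) := row_sub i W; rewrite exprS (mulmxA _ (cmx A)).
have W_neq0 : (0 < \rank W)%N.
  rewrite lt0n mxrank_eq0; apply: contraNneq v0 => W0.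
  by rewrite -submx0 -W0; apply/WP.
(* The conjugated matrix is the action of [A] on [W] in a basis of [W]; [u] is its eigenvector in
   the ambient space. *)
have [l /eigenvalueP[w w_eig w0]] := eigenvalue_closed (mxpoly.conjmx (row_base W) (cmx A)) W_neq0.
pose u := w *m row_base W.
have u0 : u != 0 by rewrite mulmx_free_eq0 ?row_base_free.
have uA : u *m cmx A = l *: u.
  rewrite scalemxAl -w_eig /u /mxpoly.conjmx -!(mulmxA w); congr (_ *m _).
  by rewrite mulmxKpV // stablemx_row_base.
have uB : u *m cmx B = 0.
  have /WP/(_ 0) : (u <= W)%MS by rewrite mulmx_sub // eq_row_base.
  by rewrite expr0 mulmx1.
case/eqP: u0; move/row_free_kerP: (full l); apply.
by rewrite mul_mx_row mulmxBr mul_mx_scalar uA subrr uB row_mx0.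
Qed.

End Controllability.

(** * Zero transfer functions have zero Markov parameters *)

Lemma size_adj_char_poly (S : nzRingType) n (A : 'M[S]_n) i j :
  (size (\adj (char_poly_mx A) i j) <= n)%N.
Proof.
rewrite mxE /cofactor size_Msign.
case: n => [|n] in A i j *; first by case: i.
apply: leq_trans (size_sum _ _ _) _; apply/bigmax_leqP=> s _; rewrite size_Msign /=.
apply: (@leq_trans (\sum_(k < n) 1)%N.+1); last by rewrite sum1_card card_ord.
apply: (big_ind2 (fun (p : {poly S}) m => size p <= m.+1)%N) => [| p mp q mq IHp IHq | k _].
- by rewrite size_poly1.
- apply: leq_trans (size_polyMleq _ _) _.
  by rewrite -subn1 -addnS leq_subLR addnA leq_add.
rewrite !mxE; case: eqP => _; last by rewrite sub0r size_polyN (leq_trans (size_polyC_leq1 _)).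
by rewrite mulr1n size_XsubC.
Qed.

(** With N = X I - A, adj(N) A W = X adj(N) W - det(N) W. Where the entry of adj(N) W is zero this
    leaves - det(N) W_ij, of degree n unless W_ij = 0, while entries of adj(N) have degree below
    n. *)
Lemma adj_char_poly_step (F : fieldType) n m (A : 'M[F]_n) (W : 'M[F]_(n, m)) i j :
  (\adj (char_poly_mx A) *m map_mx polyC W) i j = 0 ->
  W i j = 0 /\ (\adj (char_poly_mx A) *m map_mx polyC (A *m W)) i j = 0.
Proof.
move=> adjW.
have adjAW : (\adj (char_poly_mx A) *m map_mx polyC (A *m W)) i j = - (char_poly A * (W i j)%:P).
  transitivity (('X *: (\adj (char_poly_mx A) *m map_mx polyC W) -
      char_poly A *: map_mx polyC W) i j).
    congr (fun_of_matrix _ i j); rewrite -[char_poly A *: _]mul_scalar_mx -mul_adj_mx -mulmxA.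
    rewrite scalemxAr -mulmxBr; congr (_ *m _).
    by rewrite /char_poly_mx mulmxBl mul_scalar_mx opprB addrC subrK map_mxM.
  by rewrite !mxE; move: adjW; rewrite mxE => ->; rewrite mulr0 sub0r.
have Wij : W i j = 0.
  apply/eqP; apply: contraT => Wij.
  have: (size ((\adj (char_poly_mx A) *m map_mx polyC (A *m W)) i j) <= n)%N.
    rewrite mxE; apply: leq_trans (size_sum _ _ _) _; apply/bigmax_leqP => k _.
    rewrite [map_mx _ _ _ _]mxE mulrC mul_polyC (leq_trans (size_scale_leq _ _)) //.
    exact: size_adj_char_poly.
  by rewrite adjAW size_polyN mulrC mul_polyC size_scale // size_char_poly ltnn.
by rewrite adjAW Wij mulr0 oppr0.
Qed.

Lemma adj_char_poly_eq0 (F : fieldType) n m (A : 'M[F]_n) (W : 'M[F]_(n, m)) i j :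
  (\adj (char_poly_mx A) *m map_mx polyC W) i j = 0 ->
  forall k, (A ^+ k *m W) i j = 0.
Proof.
move=> + k; elim: k W => [|k IHk] W /adj_char_poly_step[Wij adjAW].
  by rewrite expr0 mul1mx.
by rewrite exprSr -mulmxA IHk.
Qed.

(** * Rank one updates *)

Section ResolventField.
Variables (F : fieldType) (n m : nat).
Implicit Types (M : 'M[F]_n) (B : 'M[F]_(n, m)).

Lemma resolvent_unit M B : M \in unitmx ->
  resolvent M B = \det M *: col_mx (invmx M *m B) 1%:M.
Proof.
move=> uM; rewrite /resolvent scale_col_mx scalemx1 scalemxAl /invmx uM.
by rewrite scalerA divff ?scale1r // -unitfE -unitmxE.
Qed.

Lemma resolvent_eq0 M B j k : M \in unitmx ->
  (resolvent M B j k == 0) = (col_mx (invmx M *m B) 1%:M j k == 0).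
Proof.
move=> uM; rewrite resolvent_unit // mxE mulf_eq0.
by move: uM; rewrite unitmxE unitfE => /negPf->.
Qed.

Lemma invmx_eq0 M i j : M \in unitmx -> (invmx M i j == 0) = (\adj M i j == 0).
Proof.
move=> uM; rewrite /invmx uM mxE mulf_eq0 invr_eq0.
by move: uM; rewrite unitmxE unitfE => /negPf->.
Qed.

(** The first equation times the adjugate gives det(M) w = a c adj(M). Inserted in the second, it
    shows that [a] times a nonzero vector is zero, so [a] and then [w] vanish. *)
Lemma rank1_kernel_eq0 M B (a : F) (c : 'rV_n) (d : 'rV_m) (w : 'rV_n) :
  \det M != 0 -> row_mx c d *m resolvent M B != 0 ->
  w *m M = a *: c -> w *m B = - (a *: d) -> w = 0.
Proof.
move=> detM res0 wM wB.
have dw : \det M *: w = a *: (c *m \adj M).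
  by rewrite scalemxAl -wM -mulmxA mul_mx_adj mul_mx_scalar.
have : a *: (row_mx c d *m resolvent M B) = 0.
  rewrite mul_row_col mul_mx_scalar scalerDr mulmxA scalemxAl -dw -scalemxAl wB.
  by rewrite scalerN scalerA mulrC -scalerA addrC subrr.
move=> /eqP; rewrite scaler_eq0 (negPf res0) orbF => /eqP a0.
by apply/eqP; move/eqP: dw; rewrite a0 scale0r scaler_eq0 (negPf detM).
Qed.

(* With H and H' the two transfer matrices, H' = H + t M^-1 e (c H' + d). *)
Lemma rank1_update_row M B (t : F) (e : 'cV_n) (c : 'rV_n) (d : 'rV_m) l :
  M \in unitmx -> M - t *: (e *m c) \in unitmx -> t != 0 ->
  row_mx c d *m resolvent M B != 0 -> (\adj M *m e) l 0 != 0 ->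
  row (lshift m l) (resolvent M B) = 0 ->
  row (lshift m l) (resolvent (M - t *: (e *m c)) (B + t *: (e *m d))) != 0.
Proof.
set M' := M - _; set B' := B + _ => uM uM' t0 res0 adj0.
have [dM dM'] : \det M != 0 /\ \det M' != 0 by rewrite -!unitfE -!unitmxE.
move: res0; rewrite !resolvent_unit // -scalemxAr scaler_eq0 negb_or => /andP[_].
rewrite mul_row_col mulmx1.
set H := invmx M *m B; set H' := invmx M' *m B' => res0.
have rowlE a (X : 'M[F]_(n, m)) : row (lshift m l) (a *: col_mx X 1%:M) = a *: row l X.
  by apply/rowP => k; rewrite !mxE (unsplitK (inl l)).
rewrite !rowlE => /eqP; rewrite !scaler_eq0 (negPf dM) (negPf dM') /= => /eqP Hl.
apply: contraNneq res0 => H'l.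
have H'E : H' = H + t *: (invmx M *m e *m (c *m H' + d)).
  have MH' : M *m H' = B + t *: (e *m (c *m H' + d)).
    have : M' *m H' = B' by rewrite mulmxA mulmxV // mul1mx.
    rewrite mulmxBl => /eqP; rewrite subr_eq => /eqP->.
    by rewrite mulmxDr scalerDr -scalemxAl mulmxA addrAC addrA.
  by rewrite -[LHS](mulKmx uM) MH' [LHS]mulmxDr -scalemxAr mulmxA.
(* Row [l] of the update formula reads 0 = t (M^-1 e)_l (c H' + d), with nonzero scalars. Then H' =
   H, so c H + d = 0, which [res0] excludes. *)
have z0 : c *m H' + d = 0.
  have := congr1 (row l) H'E; rewrite linearD linearZ /= H'l Hl add0r row_mul.
  rewrite [row l (invmx M *m e)](_ : _ = ((invmx M *m e) l 0)%:M); last first.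
    by apply/rowP => k; rewrite !ord1 !mxE mulr1n.
  rewrite mul_scalar_mx => /esym/eqP; rewrite !scaler_eq0 (negPf t0) /=.
  suff /negPf-> : (invmx M *m e) l 0 != 0 by move=> /eqP.
  by rewrite /invmx uM -scalemxAl mxE mulf_neq0 // invr_neq0.
have <- : H' = H by rewrite [LHS]H'E z0 mulmx0 scaler0 addr0.
by rewrite z0.
Qed.

End ResolventField.

(** Support of (X I - A)^-1, read off the adjugate to stay within polynomials. *)
Definition resolvent_supp (R : realType) n (A : 'M[R]_n) i j : bool :=
  \adj (char_poly_mx A) i j != 0.

Lemma lsubmx_delta (S : nzRingType) n p q (i : 'I_n) (j : 'I_(p + q)) :
  lsubmx (delta_mx i j : 'M[S]_(n, p + q)) = delta_mx i (0 : 'I_1) *m lsubmx (delta_mx 0 j).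
Proof. by rewrite mulmx_lsub mul_delta_mx. Qed.

Lemma rsubmx_delta (S : nzRingType) n p q (i : 'I_n) (j : 'I_(p + q)) :
  rsubmx (delta_mx i j : 'M[S]_(n, p + q)) = delta_mx i (0 : 'I_1) *m rsubmx (delta_mx 0 j).
Proof. by rewrite mulmx_rsub mul_delta_mx. Qed.

(** * Perturbed pencils and their modes *)

Section Perturbation.
Variables (R : realType) (n m : nat) (A : 'M[R]_n) (B : 'M[R]_(n, m)).
Implicit Types (D E : 'M[R]_(n, n + m)) (t : R) (l : R[i]).

(** [D] holds [dA, dB] in one matrix, so its entry (i, j) corresponds to the digraph edge from z_j
    to x_i. *)
Definition pertA D := A + lsubmx D.
Definition pertB D := B + rsubmx D.

Definition pencil l D : 'M[R[i]]_(n, n + m) :=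
  row_mx (l%:M - cmx (pertA D)) (cmx (pertB D)).

(** Algebraic substitute for reachability: under [D], some input has a transfer function to z_j that
    is not identically zero. *)
Definition reached D (j : 'I_(n + m)) : bool :=
  [exists k, resolvent (char_poly_mx (pertA D)) (map_mx polyC (pertB D)) j k != 0].

Lemma pencilD l D E t : pencil l (D + t *: E) =
  pencil l D + real_complex R t *: row_mx (- cmx (lsubmx E)) (cmx (rsubmx E)).
Proof.
rewrite /pencil scale_row_mx add_row_mx /pertA /pertB !linearD !linearZ /=.
rewrite !addrA !cmxE !map_mxD !map_mxZ scalerN; congr row_mx.
by rewrite opprD addrA.
Qed.

Lemma char_poly_mx_pertD D E t : char_poly_mx (pertA (D + t *: E)) =
  char_poly_mx (pertA D) + t%:P *: (- map_mx polyC (lsubmx E)).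
Proof.
by rewrite /char_poly_mx /pertA linearD linearZ /= !map_mxD map_mxZ scalerN !opprD !addrA.
Qed.

Lemma pertBD D E t : map_mx polyC (pertB (D + t *: E)) =
  map_mx polyC (pertB D) + t%:P *: map_mx polyC (rsubmx E).
Proof. by rewrite /pertB linearD linearZ /= !map_mxD map_mxZ addrA. Qed.

Lemma cofin_pencil l D E : row_free (pencil l D) ->
  cofin (fun t => row_free (pencil l (D + t *: E))).
Proof.
move=> /(cofin_row_free (real_complex R) (row_mx (- cmx (lsubmx E)) (cmx (rsubmx E)))).
by apply: sub_cofin => t; rewrite pencilD.
Qed.

Lemma cofin_reached D E j : reached D j -> cofin (fun t => reached (D + t *: E) j).
Proof.
case/existsP => k /(cofin_resolvent polyC (- map_mx polyC (lsubmx E)) (map_mx polyC (rsubmx E))).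
apply: sub_cofin => t; rewrite -char_poly_mx_pertD -pertBD => ?.
by apply/existsP; exists k.
Qed.

Lemma cofin_resolvent_supp D E i j : resolvent_supp (pertA D) i j ->
  cofin (fun t => resolvent_supp (pertA (D + t *: E)) i j).
Proof.
rewrite /resolvent_supp.
have adjE (M : 'M[{poly R}]_n) : resolvent M 1%:M (lshift n i) j = \adj M i j.
  by rewrite /resolvent col_mxEu mulmx1.
rewrite -adjE => /(cofin_resolvent polyC (- map_mx polyC (lsubmx E)) 0).
by apply: sub_cofin => t; rewrite scaler0 addr0 -char_poly_mx_pertD adjE.
Qed.

Lemma finite_modes D (i : 'I_n) j : reached D j ->
  exists s : seq R[i], forall l t, l \notin s -> row_free (pencil l (D + t *: delta_mx i j)).
Proof.
case/existsP => k; set r := resolvent _ _ => r0.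
(* Off the roots of [q], which does not depend on [t], [l] is no eigenvalue of [pertA D] and the
   transfer function from input [k] to z_j is nonzero at [l]. *)
pose q := map_poly (real_complex R) (char_poly (pertA D) * r j k).
have /finite_roots[s sP] : q != 0.
  by rewrite map_poly_eq0 mulf_neq0 // monic_neq0 // char_poly_monic.
exists s => l t ls; apply/row_free_kerP => w.
pose ev : {rmorphism {poly R} -> R[i]} := horner_eval l \o map_poly (real_complex R).
have evM : map_mx ev (char_poly_mx (pertA D)) = l%:M - cmx (pertA D).
  apply/matrixP => a b; rewrite !mxE /= /horner_eval rmorphB /= map_polyC hornerD hornerN hornerC.
  by rewrite rmorphMn /= map_polyX hornerMn hornerX.
have evB : map_mx ev (map_mx polyC (pertB D)) = cmx (pertB D).
  by apply/matrixP => a b; rewrite !mxE /= /horner_eval map_polyC hornerC.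
have : ev (char_poly (pertA D) * r j k) != 0 by apply: contra ls => qs; apply: sP.
rewrite rmorphM mulf_eq0 negb_or -det_map_mx evM => /andP[detM rjk].
pose c : 'rV[R[i]]_n := lsubmx (delta_mx 0 j).
pose d : 'rV[R[i]]_m := rsubmx (delta_mx 0 j).
have cE : cmx (lsubmx (delta_mx i j : 'M[R]_(n, n + m))) = delta_mx i 0 *m c.
  by rewrite cmxE map_lsubmx map_delta_mx lsubmx_delta.
have dE : cmx (rsubmx (delta_mx i j : 'M[R]_(n, n + m))) = delta_mx i 0 *m d.
  by rewrite cmxE map_rsubmx map_delta_mx rsubmx_delta.
have wE (p : nat) (x : 'rV[R[i]]_p) : w *m (delta_mx i 0 *m x) = w 0 i *: x.
  rewrite mulmxA -colE (_ : col i w = (w 0 i)%:M) ?mul_scalar_mx //.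
  by apply/rowP => a; rewrite !ord1 !mxE mulr1n.
rewrite pencilD mulmxDr -scalemxAr !mul_mx_row scale_row_mx add_row_mx cE dE mulmxN !wE.
rewrite -(row_mx0 _ 1 n m) => /eq_row_mx[/eqP wM /eqP wB].
move: wM wB; rewrite scalerN subr_eq0 addr_eq0 !scalerA => /eqP wM /eqP wB.
apply: (rank1_kernel_eq0 detM _ wM wB).
rewrite hsubmxK -evM -evB -map_resolvent -rowE.
by apply: contraNneq rjk => /rowP/(_ k); rewrite !mxE => ->.
Qed.

End Perturbation.

(** * Input-reachability *)

Section Transfer.
Variables (R : realType) (n m : nat) (A : 'M[R]_n) (B : 'M[R]_(n, m)).

Lemma charF_unit : charF A \in unitmx.
Proof.
by rewrite unitmxE unitfE det_map_mx tofrac_eq0 monic_neq0 ?char_poly_monic.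
Qed.

Lemma resolvent_frac (C : 'M[R]_(n, m)) :
  map_mx (@tofrac _) (resolvent (char_poly_mx A) (map_mx polyC C)) =
  resolvent (charF A) (map_mx (@rat_const R) C).
Proof. by rewrite map_resolvent -map_mx_comp. Qed.

Lemma Gzu_neq0 j k :
  (Gzu A B j k != 0) = (resolvent (char_poly_mx A) (map_mx polyC B) j k != 0).
Proof.
have /matrixP/(_ j k) := resolvent_frac B; rewrite mxE => resE.
by rewrite -[X in ~~ X](resolvent_eq0 _ _ _ charF_unit) -resE tofrac_eq0.
Qed.

Lemma Gzx_lshift i j : (Gzx m A (lshift m i) j != 0) = resolvent_supp A i j.
Proof.
rewrite /Gzx col_mxEu (invmx_eq0 _ _ charF_unit).
have /matrixP/(_ i j) := map_mx_adj (@tofrac {poly R}) (char_poly_mx A).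
rewrite mxE => adjE.
by rewrite -[\adj (charF A)]/(\adj (map_mx (@tofrac _) (char_poly_mx A))) -adjE tofrac_eq0.
Qed.

Lemma Gzx_rshift k j : Gzx m A (rshift n k) j = 0.
Proof. by rewrite /Gzx col_mxEd mxE. Qed.

End Transfer.

Lemma char_poly_mx_unit (R : realType) n (A : 'M[R]_n) :
  map_mx (@tofrac _) (char_poly_mx A) \in unitmx.
Proof. exact: charF_unit. Qed.

Section Reachability.
Variables (R : realType) (n m : nat) (A : 'M[R]_n) (B : 'M[R]_(n, m)).
Variables (PA : pattern n n) (PB : pattern n m).
Local Notation P := (row_mx PA PB).
Local Notation reached := (reached A B).
Local Notation ireach := (input_reachable A B PA PB).
Implicit Types (D E : 'M[R]_(n, n + m)).

Lemma fits0 : fits P (0 : 'M[R]_(n, n + m)).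
Proof. by move=> i j _; rewrite mxE. Qed.

Lemma fitsD p q (Q : pattern p q) (D E : 'M[R]_(p, q)) (t : R) :
  fits Q D -> fits Q E -> fits Q (D + t *: E).
Proof. by move=> fD fE i j Qij; rewrite !mxE fD // fE // mulr0 addr0. Qed.

Lemma fits_delta p q (Q : pattern p q) i j : Q i j -> fits Q (delta_mx i j : 'M[R]_(p, q)).
Proof. by move=> Qij a b; rewrite mxE; case: andP => // -[/eqP-> /eqP->]; rewrite Qij. Qed.

(** If z_l is not yet reached, every nonzero [t] works, by [rank1_update_row] over the rational
    functions; otherwise being reached survives a generic change. *)
Lemma reached_edge D i j l : reached D j -> resolvent_supp (pertA A D) l i ->
  cofin (fun t => reached (D + t *: delta_mx i j) (lshift m l)).
Proof.
move=> rj adj0; have [/cofin_reached//|nrl] := boolP (reached D (lshift m l)).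
apply: sub_cofin (cofin_neq 0) => t t0.
pose F := ratR R; pose f : {rmorphism {poly R} -> F} := @tofrac _.
have f_eq0 x : (f x == 0) = (x == 0) by exact: tofrac_eq0.
pose M := map_mx f (char_poly_mx (pertA A D)).
pose C := map_mx f (map_mx polyC (pertB B D)).
pose c : 'rV[F]_n := lsubmx (delta_mx 0 j).
pose d : 'rV[F]_m := rsubmx (delta_mx 0 j).
pose e : 'cV[F]_n := delta_mx i 0.
have M'E : map_mx f (char_poly_mx (pertA A (D + t *: delta_mx i j))) = M - f t%:P *: (e *m c).
  rewrite char_poly_mx_pertD map_mxD map_mxZ map_mxN scalerN map_lsubmx map_lsubmx.
  by rewrite !map_delta_mx lsubmx_delta.
have C'E : map_mx f (map_mx polyC (pertB B (D + t *: delta_mx i j))) = C + f t%:P *: (e *m d).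
  rewrite pertBD map_mxD map_mxZ map_rsubmx map_rsubmx.
  by rewrite !map_delta_mx rsubmx_delta.
have : row (lshift m l) (resolvent (M - f t%:P *: (e *m c)) (C + f t%:P *: (e *m d))) != 0.
  apply: rank1_update_row => //.
  - exact: char_poly_mx_unit.
  - by rewrite -M'E; apply: char_poly_mx_unit.
  - by rewrite f_eq0 polyC_eq0.
  - rewrite hsubmxK -rowE -map_resolvent; case/existsP: rj => k.
    by apply: contraNneq => /rowP/(_ k); rewrite !mxE => /eqP; rewrite f_eq0.
  - by rewrite -colE -map_mx_adj mxE mxE f_eq0.
  - apply/rowP => k; rewrite -map_resolvent mxE mxE [RHS]mxE; apply/eqP; rewrite f_eq0.
    by apply: contraNT nrl => rk; apply/existsP; exists k.
rewrite -M'E -C'E -map_resolvent => r0; apply: contraNT r0 => nr.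
apply/eqP/rowP => k; rewrite mxE mxE [RHS]mxE; apply/eqP; rewrite f_eq0.
by apply: contraNT nr => rk; apply/existsP; exists k.
Qed.

(** Invariant of the growth argument: no edge from x to z and no reached vertex of the unperturbed
    system is lost. *)
Definition dominates0 D :=
  [/\ fits P D, forall l i, resolvent_supp A l i -> resolvent_supp (pertA A D) l i
    & forall j, reached 0 j -> reached D j].

Lemma ltn_card_setC (T : finType) (p q : pred T) x :
  (forall y, p y -> q y) -> ~~ p x -> q x -> (#|[set y | ~~ q y]| < #|[set y | ~~ p y]|)%N.
Proof.
move=> pq px qx; apply: proper_card; apply/properP; split.
  by apply/subsetP => y; rewrite !in_set; apply: contra => /pq.
by exists x; rewrite in_set // qx.
Qed.

Lemma connect_ind (T : finType) (e : rel T) (Q : T -> Prop) x y :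
  (forall a b, e a b -> Q a -> Q b) -> Q x -> connect e x y -> Q y.
Proof.
move=> eQ Qx /connectP[p + ->]; elim: p x Qx => [//|a p IHp] x Qx /= /andP[exa].
by apply: IHp; apply: eQ exa Qx.
Qed.

(** Greedy growth: while an allowed entry leads from a reached z_j through x_i to an unreached z_l,
    a generic change of it reaches z_l and loses nothing. Once stuck, reachedness propagates along
    every path of the digraph. *)
Lemma exists_reached : (forall j, ireach (vz j)) ->
  exists2 D, fits P D & forall j, reached D j.
Proof.
move=> allr.
have dom0 : dominates0 0.
  by split=> [|l i|//]; [exact: fits0 | rewrite /pertA linear0 addr0].
have [k] := ubnP #|[set j | ~~ reached 0 j]|.
elim: k (0 : 'M_(n, n + m)) dom0 => // k IHk D [fD adjD rD] cardD.
have [/existsP[i /existsP[j /existsP[l /and4P[Pij rj adj0 nrl]]]]|stuck] :=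
  boolP [exists i, exists j, exists l, [&& P i j, reached D j,
    resolvent_supp A l i & ~~ reached D (lshift m l)]].
  pose D' t := D + t *: delta_mx i j.
  have cof : cofin (fun t => [/\ forall l' i', resolvent_supp A l' i' ->
      resolvent_supp (pertA A (D' t)) l' i',
      forall j', reached D j' -> reached (D' t) j' & reached (D' t) (lshift m l)]).
    have c1 : cofin (fun t => forall l' i', resolvent_supp A l' i' ->
        resolvent_supp (pertA A (D' t)) l' i').
      apply: cofin_fin => l'; apply: cofin_fin => i'.
      have [a0|na0] := boolP (resolvent_supp A l' i').
        have := cofin_resolvent_supp (delta_mx i j) (adjD _ _ a0).
        by apply: sub_cofin => t rt _.
      by exists [::].
    have c2 : cofin (fun t => forall j', reached D j' -> reached (D' t) j').
      apply: cofin_fin => j'; have [rj'|] := boolP (reached D j'); last by exists [::].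
      by have := cofin_reached (delta_mx i j) rj'; apply: sub_cofin => t rt _.
    have c3 := reached_edge rj (adjD _ _ adj0).
    by apply: sub_cofin (cofinI c1 (cofinI c2 c3)) => t [? []].
  have [t [adjD' rD' rl]] := cofin_ex cof.
  have domD' : dominates0 (D' t).
    split; [exact: fitsD fD (fits_delta Pij) | exact: adjD' | by move=> j' rj'; apply/rD'/rD].
  apply: (IHk (D' t) domD').
  rewrite ltnS in cardD; apply: leq_trans cardD; exact: ltn_card_setC rD' nrl rl.
exists D => // j; have [u uj] := allr j.
pose Q (v : acg_vertex n m) : Prop := match v with
  | inl j => reached D j | inr (inl i) => exists2 j, P i j & reached D j
  | inr (inr _) => True end.
suff Qe a b : acg_edge A B PA PB a b -> Q a -> Q b by exact: (connect_ind (Q := Q) Qe _ uj).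
move: a b => {uj j} [j|[i|u']] [j'|[i'|u'']] //=.
- by move=> Pij rj; exists j.
- move=> G0 [j Pij rj]; case: (split_ordP j') G0 => [l ->|l ->]; last by rewrite Gzx_rshift eqxx.
  rewrite Gzx_lshift => adj0; apply: contraNT stuck => nrl.
  apply/existsP; exists i; apply/existsP; exists j; apply/existsP; exists l.
  by rewrite Pij rj adj0 nrl.
- move=> G0 _; apply: rD; apply/existsP; exists u'.
  by rewrite /pertA /pertB !linear0 !addr0 -Gzu_neq0.
Qed.

Lemma ireach_edge a b : ireach a -> acg_edge A B PA PB a b -> ireach b.
Proof.
by move=> [u ua] ab; exists u; apply: connect_trans ua _; apply: connect1.
Qed.

Lemma ireach_u k : ireach (vu n k).
Proof. by exists k; apply: connect0. Qed.

Lemma ireach_zu k : ireach (vz (rshift n k)).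
Proof.
by apply: ireach_edge (ireach_u k) _; rewrite /= /Gzu col_mxEd mxE eqxx oner_neq0.
Qed.

Lemma controllable_ireach dA dB : fits PA dA -> fits PB dB ->
  controllable (A + dA) (B + dB) -> forall i, ireach (vz i).
Proof.
move=> fA fB /controllableP ctrl i; case: (split_ordP i) => [l ->|k ->]; last exact: ireach_zu.
apply: contrapT => nrl.
(* A space given by equations: stable under [A], it contains e_j for every unreachable z_j, and its
   vectors vanish at the reachable x coordinates (case k = 0). *)
pose V (v : 'rV[R]_n) := (forall k i, ireach (vx m i) -> (v *m A ^+ k) 0 i = 0) /\
  (forall k, v *m A ^+ k *m B = 0).
(* No edge enters z_j from a reachable x or from an input, so these transfer functions and their
   Markov parameters are zero. *)
have Vdelta j : ~ ireach (vz (lshift m j)) -> V (delta_mx 0 j).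
  move=> nrj; split=> [k i' ri'|k].
    rewrite -rowE mxE -[A ^+ k]mulmx1; apply: adj_char_poly_eq0.
    rewrite map_mx1 mulmx1; apply: contra_notP nrj => /eqP.
    by rewrite -[_ != 0]/(resolvent_supp A j i') -(Gzx_lshift m) => G0; apply: ireach_edge ri' _.
  rewrite -mulmxA -rowE; apply/rowP => u; rewrite mxE [RHS]mxE.
  apply: adj_char_poly_eq0; apply: contra_notP nrj => /eqP adj0.
  apply: ireach_edge (ireach_u u) _; rewrite /= Gzu_neq0.
  by rewrite /resolvent col_mxEu.
have V0 : V 0 by split=> *; rewrite ?mul0mx ?mxE ?mul0mx.
have VD v w : V v -> V w -> V (v + w).
  move=> [v1 v2] [w1 w2]; split=> [k i' ri'|k]; last by rewrite !mulmxDl v2 w2 addr0.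
  by rewrite mulmxDl mxE v1 // w1 // addr0.
have VZ a v : V v -> V (a *: v).
  move=> [v1 v2]; split=> [k i' ri'|k]; last by rewrite -!scalemxAl v2 scaler0.
  by rewrite -scalemxAl mxE v1 // mulr0.
have VA v : V v -> V (v *m A).
  move=> [v1 v2]; split=> [k i' ri'|k].
    by have := v1 k.+1 _ ri'; rewrite exprS (mulmxA v A).
  by have := v2 k.+1; rewrite exprS (mulmxA v A).
have Vsupp v i' : V v -> ireach (vx m i') -> v 0 i' = 0.
  by move=> [v1 _] /(v1 0); rewrite expr0 mulmx1.
(* If z_j is reachable, so is x_i wherever [PA i j] holds; [v] is zero there, so column j of
   [v *m dA] vanishes. The other columns contribute multiples of vectors e_j in [V]. *)
have VdA v : V v -> V (v *m dA).
  move=> Vv; rewrite [v *m dA]row_sum_delta.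
  apply: (big_ind V) => // j _.
  have [r|/Vdelta/VZ//] := pselect (ireach (vz (lshift m j))).
  suff -> : (v *m dA) 0 j = 0 by rewrite scale0r.
  rewrite mxE big1 // => i' _; have [PAij|/negPf/fA->] := boolP (PA i' j); last by rewrite mulr0.
  rewrite (Vsupp v) ?mul0r //; apply: ireach_edge r _.
  by rewrite /= row_mxEl.
have vdB v : V v -> v *m dB = 0.
  move=> Vv; apply/rowP => u; rewrite mxE [RHS]mxE big1 // => i' _.
  have [PBij|/negPf/fB->] := boolP (PB i' u); last by rewrite mulr0.
  rewrite (Vsupp v) ?mul0r //; apply: ireach_edge (ireach_zu u) _.
  by rewrite /= row_mxEr.
have Vpow k : V (delta_mx 0 l *m (A + dA) ^+ k).
  elim: k => [|k IHk]; first by rewrite expr0 mulmx1; apply: Vdelta.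
  rewrite exprSr (mulmxA _ _ (A + dA)) mulmxDr; apply: VD; [exact: VA | exact: VdA].
have : cmx (delta_mx 0 l : 'rV[R]_n) = 0.
  apply: ctrl => k; rewrite -cmxX !cmxE -!map_mxM mulmxDr vdB // addr0.
  by case: (Vpow k) => _ /(_ 0); rewrite expr0 mulmx1 => ->; rewrite map_mx0.
by move/rowP/(_ l); rewrite !mxE !eqxx => /eqP; rewrite oner_eq0.
Qed.

End Reachability.

(** * Matroid intersection *)

Section Minors.
Variable F : fieldType.

Lemma mxrank_colsub p q r (h : 'I_r -> 'I_q) (X : 'M[F]_(p, q)) :
  (\rank (colsub h X) <= \rank X)%N.
Proof. by rewrite -[X in colsub h X]mulmx1 -mulmx_colsub mxrankM_maxl. Qed.

Lemma mxrank_rowsub p q r (h : 'I_r -> 'I_p) (X : 'M[F]_(p, q)) :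
  (\rank (rowsub h X) <= \rank X)%N.
Proof. by rewrite rowsubE mxrankM_maxr. Qed.

Lemma det_neq0_row_free n (X : 'M[F]_n) : (\det X != 0) = row_free X.
Proof. by rewrite row_free_unit unitmxE unitfE. Qed.

Lemma row_full_minor p q (X : 'M[F]_(p, q)) : row_full X ->
  exists2 g : 'I_q -> 'I_p, injective g & \det (rowsub g X) != 0.
Proof.
move=> fX; exists (fullrankfun fX); first exact: fullrankfun_inj.
by rewrite det_neq0_row_free fullrowsub_free.
Qed.

Lemma row_free_minor p q (X : 'M[F]_(p, q)) : row_free X ->
  exists2 g : 'I_p -> 'I_q, injective g & \det (colsub g X) != 0.
Proof.
rewrite /row_free -mxrank_tr => /row_full_minor[g g_inj gX]; exists g => //.
by rewrite -det_tr trmx_mxsub.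
Qed.

Lemma minor_row_free p q (g : 'I_p -> 'I_q) (X : 'M[F]_(p, q)) :
  \det (colsub g X) != 0 -> row_free X.
Proof.
rewrite det_neq0_row_free -!row_leq_rank => /leq_trans; apply; exact: mxrank_colsub.
Qed.

Lemma minor_inj p q (g : 'I_p -> 'I_q) (X : 'M[F]_(p, q)) :
  \det (colsub g X) != 0 -> injective g.
Proof.
move=> gX i j gij; apply: contraTeq gX => ij; rewrite negbK -det_tr.
by apply/eqP; apply: (determinant_alternate ij) => k; rewrite !mxE gij.
Qed.

Lemma det_mulmx_expand n q (K : 'M[F]_(n, q)) (L : 'M[F]_(q, n)) :
  \det (K *m L) = \sum_(f : {ffun 'I_n -> 'I_q}) (\prod_j L (f j) j) * \det (colsub f K).
Proof.
rewrite -det_tr.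
transitivity (\sum_(s : 'S_n) \sum_(f : {ffun 'I_n -> 'I_q})
    (-1) ^+ s * \prod_j (K (s j) (f j) * L (f j) j)).
  apply: eq_bigr => s _; rewrite -mulr_sumr; congr (_ * _).
  rewrite -(bigA_distr_bigA (fun j k => K (s j) k * L k j)) /=.
  by apply: eq_bigr => j _; rewrite !mxE.
rewrite exchange_big; apply: eq_bigr => f _; rewrite -det_tr mulr_sumr.
apply: eq_bigr => s _; rewrite big_split /= [RHS]mulrCA; congr (_ * _).
by rewrite mulrC; congr (_ * _); apply: eq_bigr => j _; rewrite !mxE.
Qed.

Lemma det_mulmx_neq0 n q (K : 'M[F]_(n, q)) (L : 'M[F]_(q, n)) :
  \det (K *m L) != 0 ->
  exists2 f : 'I_n -> 'I_q, \det (colsub f K) != 0 & forall j, L (f j) j != 0.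
Proof.
rewrite det_mulmx_expand => KL0.
have [/existsP[f /andP[Lf Kf]]|none] :=
    boolP [exists f : {ffun 'I_n -> 'I_q}, (\prod_j L (f j) j != 0) && (\det (colsub f K) != 0)].
  by exists f => // j; move/prodf_neq0: Lf; apply.
case/eqP: KL0; apply: big1 => f _; apply/eqP; rewrite mulf_eq0.
by apply: contraNT none; rewrite negb_or => Hf; apply/existsP; exists f.
Qed.

End Minors.

(** A nonzero minor has a nonzero Leibniz term, which is a matching; conversely the 0-1 matrix of a
    matching has full column rank. *)
Lemma grank_matching (R : realType) p k (Q : pattern p k) :
  grank_is R Q k <-> exists2 g : 'I_k -> 'I_p, injective g & forall j, Q (g j) j.
Proof.
split=> [[[M [fM rM]] _]|[g g_inj gQ]].
  have /row_full_minor[g g_inj] : row_full M by apply/eqP.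
  rewrite -det_tr => detM.
  have [s Ms] : exists s : 'S_k, \prod_j M (g (s j)) j != 0.
    apply: contrapT => none; case/eqP: detM; apply: big1 => s _.
    rewrite (_ : \prod_i _ = \prod_j M (g (s j)) j); last by apply: eq_bigr => j _; rewrite !mxE.
    have [->|M0] := eqVneq (\prod_j M (g (s j)) j) 0; first by rewrite mulr0.
    by case: none; exists s.
  exists (fun j => g (s j)) => [i j /g_inj/perm_inj//|j].
  by move/prodf_neq0/(_ j isT): Ms; apply: contraNT => /negPf/fM->.
split; last by move=> M _; apply: rank_leq_col.
exists (\matrix_(a, j) (a == g j)%:R); split.
  by move=> a j; rewrite mxE; case: eqP => // ->; rewrite gQ.
apply/eqP; rewrite eqn_leq rank_leq_col /=.
apply: leq_trans (mxrank_rowsub g _); rewrite (_ : rowsub g _ = 1%:M) ?mxrank1 //.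
by apply/matrixP => i j; rewrite !mxE (inj_eq g_inj).
Qed.

Section Matching.
Variables (R : realType) (n m : nat) (A : 'M[R]_n) (B : 'M[R]_(n, m)).
Variables (PA : pattern n n) (PB : pattern n m) (l : R[i]).
Local Notation P := (row_mx PA PB).
Local Notation W1 := (W1_mx A B l).
Local Notation W2 := (W2_pat PA PB).

(** Common form of the rank and matroid conditions: [f] picks a column basis of [I, l I - A, B], and
    [g] matches it to stars of the second matrix. *)
Definition matched := exists f : 'I_n -> 'I_(n + (n + m)), exists g : 'I_n -> 'I_(n + m),
  [/\ injective g, \det (colsub f W1) != 0 & forall j, W2 (g j) (f j)].

Lemma matroid_matched :
  matroid_inter_card (indep_num W1) (indep_pat R W2) n <-> matched.
Proof.
split=> [[[I [indI [/grank_matching[g g_inj gQ] cardI]]] _]|[f [g [g_inj detf W2fg]]]].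
  pose c := cast_ord (esym cardI).
  exists (fun j => enum_val (c j)), (fun j => g (c j)); split.
  - by move=> i j /g_inj/cast_ord_inj.
  - rewrite det_neq0_row_free -row_leq_rank -[X in (X <= _)%N]cardI -indI.
    rewrite -[X in (\rank X <= _)%N](_ :
      colsub (cast_ord cardI) (colsub (fun j => enum_val (c j)) W1) = _).
      exact: mxrank_colsub.
    by apply/matrixP => i j; rewrite !mxE /c cast_ordK.
  - by move=> j; have := gQ (c j); rewrite mxE.
split; last first.
  by move=> I <- _; apply: rank_leq_row.
have f_inj := minor_inj detf.
pose I := [set f j | j : 'I_n].
have cardI : #|I| = n by rewrite card_imset // card_ord.
have fI j : f j \in I by apply: imset_f.
exists I; split; last split=> //.
  apply/eqP; rewrite eqn_leq rank_leq_col /= [X in (X <= _)%N]cardI.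
  move: detf; rewrite det_neq0_row_free -row_leq_rank => /leq_trans; apply.
  rewrite [colsub f W1](_ : _ = colsub (fun j => enum_rank_in (fI j) (f j)) (colsubset W1 I)).
    exact: mxrank_colsub.
  by apply/matrixP => i j; rewrite !mxE enum_rankK_in.
apply/grank_matching.
have /fin_all_exists[h hE] (k : 'I_#|I|) : exists j, f j = enum_val k.
  by have /imsetP[j _ ->] := enum_valP k; exists j.
exists (fun k => g (h k)) => [i j /g_inj hij|k].
  by apply: enum_val_inj; rewrite -!hE hij.
by rewrite mxE -hE.
Qed.

(** Linear part of the pencil as an affine function of the perturbation; dA enters with a minus
    sign. *)
Definition signed (D : 'M[R]_(n, n + m)) : 'M[R[i]]_(n, n + m) :=
  row_mx (- cmx (lsubmx D)) (cmx (rsubmx D)).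

Lemma W1_pencil0 : W1 = row_mx 1%:M (pencil A B l 0).
Proof. by rewrite /W1_mx /pencil /pertA /pertB !linear0 !addr0. Qed.

Lemma pencil_matched :
  (exists2 D, fits P D & row_free (pencil A B l D)) <-> matched.
Proof.
split=> [[D fD /row_free_minor[g g_inj]]|[f [g [g_inj detf W2fg]]]].
  have -> : pencil A B l D = W1 *m col_mx (signed D) 1%:M.
    rewrite W1_pencil0 mul_row_col mul1mx mulmx1.
    by rewrite -[D in LHS]scale1r -[1 *: D]add0r pencilD scale1r addrC.
  rewrite -mulmx_colsub => /det_mulmx_neq0[f detf fL]; exists f, g; split=> // j.
  have := fL j; rewrite mxE /W2_pat; case: (split_ordP (f j)) => [i ->|b ->].
    rewrite col_mxEu row_mxEl [_^T _ _]mxE; apply: contraNT => /negPf Pij; apply/eqP.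
    move: (fD _ _ Pij); rewrite /signed; case: (split_ordP (g j)) => [a ->|a ->] Dij.
      by rewrite row_mxEl !mxE Dij oppr0.
    by rewrite row_mxEr !mxE Dij.
  rewrite col_mxEd row_mxEr !mxE; apply: contraNT; rewrite eq_sym => /negPf->.
  by rewrite eqxx.
(* [E] has a 1 where an identity column e_i is matched to column b; [E'] negates the first block to
   cancel the sign in the pencil. *)
pose E : 'M[R]_(n, n + m) := \matrix_(i, b) [exists j, (f j == lshift (n + m) i) && (g j == b)]%:R.
pose E' : 'M[R]_(n, n + m) := row_mx (- lsubmx E) (rsubmx E).
have fE' : fits P E'.
  have fE : fits P E.
    move=> i b Pib; rewrite mxE; case: existsP => //= -[j /andP[/eqP fj /eqP gj]].
    by have := W2fg j; rewrite fj gj row_mxEl mxE Pib.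
  move=> i b Pib; rewrite /E'; case: (split_ordP b) Pib => [a ->|a ->] /fE Eia.
    by rewrite row_mxEl !mxE; move: Eia; rewrite !mxE => ->; rewrite oppr0.
  by rewrite row_mxEr -[RHS]Eia !mxE.
have signedE : signed E' = cmx E.
  rewrite /signed row_mxKl row_mxKr !cmxE map_mxN opprK map_lsubmx map_rsubmx.
  by rewrite hsubmxK.
have [N NE] : exists N, N = pencil A B l 0 by eexists.
pose left j := (f j < n)%N.
(* With entries [s^-1] on the matching, column [g j] of the pencil is that of [N], plus s^-1 e_i if
   [f j] is the identity column e_i. Scaling the latter columns by [s] gives [colsub f W1] plus [s]
   times [N'], invertible at [s = 0]. *)
pose N' : 'M[R[i]]_n := \matrix_(i, j) (N i (g j) *+ left j).
have /(cofin_det (real_complex R) N') cof := detf.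
have [s [detN s0]] := cofin_ex (cofinI cof (cofin_neq 0)).
exists (0 + s^-1 *: E'); first by apply: fitsD => //; apply: fits0.
apply: (minor_row_free (g := g)); move: detN.
rewrite (_ : colsub f W1 + _ = colsub g (pencil A B l (0 + s^-1 *: E')) *m
    diag_mx (\row_j (if left j then real_complex R s else 1))); last first.
  apply/matrixP => i j; rewrite mul_mx_diag pencilD -/(signed E') signedE -NE.
  rewrite W1_pencil0 -NE [LHS]mxE [RHS]mxE [colsub f _ _ _]mxE [colsub g _ _ _]mxE.
  rewrite [(_ *: N') i j]mxE [N' i j]mxE [(\row_k _) 0 j]mxE.
  rewrite [(N + _) _ _]mxE [(_ *: cmx E) _ _]mxE [cmx E _ _]mxE [E _ _]mxE.
  have := W2fg j; rewrite /W2_pat /left; case: (split_ordP (f j)) => [i0 fj|b fj].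
    rewrite fj !row_mxEl [_^T _ _]mxE [1%:M _ _]mxE => _; rewrite mulr1n.
    rewrite (_ : [exists _, _] = (i == i0)).
      rewrite mulrDl addrC [N i (g j) * _]mulrC; congr (_ + _).
      rewrite mulrAC -rmorphM /= mulVf // rmorph1 mul1r.
      by case: (i == i0).
    apply/existsP/eqP => [[j' /andP[/eqP fj' /eqP/g_inj jj']]|->].
      by move: fj'; rewrite jj' fj => /lshift_inj.
    by exists j; rewrite fj !eqxx.
  rewrite fj !row_mxEr mxE => /eqP gj; rewrite mulr0n mulr0 addr0 mulr1 -gj.
  rewrite (_ : [exists _, _] = false) ?rmorph0 ?mulr0 ?addr0 //.
  apply/existsP => -[j' /andP[/eqP fj' /eqP/g_inj jj']].
  by move: fj'; rewrite jj' fj => /eqP; rewrite eq_rlshift.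
by rewrite det_mulmx mulf_eq0 negb_or => /andP[].
Qed.

Lemma pencil_maxrankP : pencil_maxrank_is A B PA PB l n <->
  exists2 D, fits P D & row_free (pencil A B l D).
Proof.
split=> [[[dA [dB [fA [fB /eqP full]]]] _]|[D fD full]].
  exists (row_mx dA dB).
    by move=> i j; case: (split_ordP j) => a ->; rewrite ?row_mxEl ?row_mxEr; [apply: fA|apply: fB].
  by rewrite /pencil /pertA /pertB row_mxKl row_mxKr.
split; last by move=> *; apply: rank_leq_row.
exists (lsubmx D), (rsubmx D); split; last split; last exact/eqP.
  by move=> i j Pij; rewrite mxE fD // row_mxEl.
by move=> i j Pij; rewrite mxE fD // row_mxEr.
Qed.

End Matching.

(** * Sufficiency *)

Section Sufficiency.
Variables (R : realType) (n m : nat) (A : 'M[R]_n) (B : 'M[R]_(n, m)).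
Variables (PA : pattern n n) (PB : pattern n m).
Local Notation P := (row_mx PA PB).
Implicit Types (D E : 'M[R]_(n, n + m)) (l : R[i]).

Local Notation full l D := (row_free (pencil A B l D)).

Lemma full_nonspectrum l D : ~~ spectrum (pertA A D) l -> full l D.
Proof.
move=> nspec; apply/row_free_kerP => v; rewrite mul_mx_row -(row_mx0 _ 1 n m).
move=> /eq_row_mx[/eqP]; rewrite mulmxBr mul_mx_scalar subr_eq0 => /eqP lv _.
apply: contraNeq nspec => v0; apply/eigenvalueP; exists v => //.
Qed.

(** A generic point of the line through [D] and [D'] keeps the full rank found at either; for [D']
    the line is recentred at parameter 1. *)
Lemma common_full (s : seq R[i]) :
  (forall l, l \in s -> exists2 D, fits P D & full l D) ->
  exists2 D, fits P D & forall l, l \in s -> full l D.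
Proof.
elim: s => [_|l s IHs fs]; first by exists 0 => //; apply: fits0.
have [|D fD Ds] := IHs.
  by move=> l' l's; apply: fs; rewrite inE l's orbT.
have [D' fD' D'l] := fs l (mem_head _ _).
have c1 : cofin (fun t => forall l', l' \in s -> full l' (D + t *: (D' - D))).
  by apply: cofin_seq => l' /Ds; apply: cofin_pencil.
have c2 : cofin (fun t => full l (D + t *: (D' - D))).
  have := cofin_shift (-1) (cofin_pencil (D' - D) D'l).
  apply: sub_cofin => t; suff -> : D' + (t - 1) *: (D' - D) = D + t *: (D' - D) by [].
  by rewrite scalerBl scale1r opprB [_ *: _ + _]addrC addrA [D' + (D - D')]addrC subrK.
have [t [Dt Dtl]] := cofin_ex (cofinI c1 c2).
exists (D + t *: (D' - D)).
  by move=> i j Pij; rewrite !mxE fD // fD' // subrr mulr0 addr0.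
by move=> l'; rewrite inE => /predU1P[->|/Dt].
Qed.

(* Along a single edge out of a reached vertex only finitely many modes can
   become uncontrollable, and each of them only for finitely many values. *)
Lemma cofin_edge (s : seq R[i]) D i j :
  (forall j', reached A B D j') -> (forall l, l \notin s -> full l D) ->
  cofin (fun t => (forall j', reached A B (D + t *: delta_mx i j) j') /\
    (forall l, l \notin s -> full l (D + t *: delta_mx i j))).
Proof.
move=> rD fullD; apply: cofinI.
  by apply: cofin_fin => j'; apply: cofin_reached.
have [s' s'P] := finite_modes i (rD j).
have : cofin (fun t => forall l, l \in [seq l <- s' | l \notin s] ->
    full l (D + t *: delta_mx i j)).
  by apply: cofin_seq => l; rewrite mem_filter => /andP[/fullD/cofin_pencil].
apply: sub_cofin => t fullt l ls; have [ls'|/s'P//] := boolP (l \in s').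
by apply: fullt; rewrite mem_filter ls ls'.
Qed.

(** [D] has no mode outside [s], [D'] none inside. Entry by entry both receive the same generic
    value, preserving these properties, until they coincide. *)
Lemma walk_edges (s : seq R[i]) (es : seq ('I_n * 'I_(n + m))) D D' :
  (forall e, e \in es -> P e.1 e.2) ->
  (forall i j, (i, j) \notin es -> D i j = D' i j) -> fits P D ->
  (forall j, reached A B D j) -> (forall l, l \notin s -> full l D) ->
  (forall l, l \in s -> full l D') ->
  exists2 D0, fits P D0 & forall l, full l D0.
Proof.
elim: es D D' => [|[i j] es IHes] D D' Pes DD' fD rD nsD sD'.
  have DE : D = D' by apply/matrixP => i j; apply: DD'.
  rewrite -DE in sD'.
  by exists D => // l; have [/sD'|/nsD] := boolP (l \in s).
have c1 := cofin_edge i j rD nsD.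
(* The shift makes entry (i, j) of the moved [D'] equal to [D i j + t]. *)
have c2 : cofin (fun t => forall l, l \in s ->
    full l (D' + (t + (D i j - D' i j)) *: delta_mx i j)).
  by apply: cofin_seq => l /sD'/(cofin_pencil (delta_mx i j))/(cofin_shift (D i j - D' i j)).
have [t [[rt nst] st]] := cofin_ex (cofinI c1 c2).
apply: (IHes (D + t *: delta_mx i j)) rt nst st.
- by move=> e ees; apply: Pes; rewrite inE ees orbT.
- move=> a b abes; rewrite !mxE; have [/andP[/eqP-> /eqP->]|neq] := boolP ((a == i) && (b == j)).
    by rewrite !mulr1 addrCA [D' i j + _]addrC subrK addrC.
  by rewrite !mulr0 !addr0; apply: DD'; rewrite inE negb_or xpair_eqE neq.
- by apply: fitsD => //; apply: fits_delta; apply: (Pes (i, j)); apply: mem_head.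
Qed.

Lemma controllable_suff :
  (forall l, spectrum A l -> exists2 D, fits P D & full l D) ->
  (forall j, input_reachable A B PA PB (vz j)) ->
  exists dA dB, fits PA dA /\ fits PB dB /\ controllable (A + dA) (B + dB).
Proof.
move=> fullA /exists_reached[D fD rD].
have fulll l : exists2 D, fits P D & full l D.
  have [/fullA//|nspec] := boolP (spectrum A l).
  exists 0; first exact: fits0.
  by apply: full_nonspectrum; rewrite /pertA linear0 addr0.
(* [s] contains the eigenvalues of [pertA A D], so [D] has no mode outside it; [D'] is chosen to
   have none inside. *)
have /finite_roots[s sP] : char_poly (cmx (pertA A D)) != 0.
  by rewrite monic_neq0 ?char_poly_monic.
have [D' fD' fullD'] := common_full (s := s) (fun l _ => fulll l).
have [||l ls|D0 fD0 full0] := walk_edges (es := [seq e <- enum {: 'I_n * 'I_(n + m)} | P e.1 e.2])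
    _ _ fD rD _ fullD'.
- by move=> e; rewrite mem_filter => /andP[].
- move=> i j; rewrite mem_filter mem_enum andbT => /negPf Pij.
  by rewrite fD // fD'.
- apply: full_nonspectrum; apply: contra ls.
  by rewrite /spectrum eigenvalue_root_char => /sP.
exists (lsubmx D0), (rsubmx D0); split; last split; last exact/hautus.
  by move=> i j Pij; rewrite mxE fD0 // row_mxEl.
by move=> i j Pij; rewrite mxE fD0 // row_mxEr.
Qed.

End Sufficiency.

(** Each z_{n+k} is fed by u_k. For the other vertices, an invertible matrix has no zero row, so an
    edge enters z_l from some x_j, and either end being reachable makes z_l reachable. *)
Lemma edges_zreach (R : realType) n m (A : 'M[R]_n) (B : 'M[R]_(n, m))
    (PA : pattern n n) (PB : pattern n m) :
  (forall (i : 'I_(n + m)) (j : 'I_n), Gzx m A i j != 0 ->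
     input_reachable A B PA PB (vx m j) \/ input_reachable A B PA PB (vz i)) <->
  (forall i, input_reachable A B PA PB (vz i)).
Proof.
split=> [edge i|zr i j _]; last by right.
case: (split_ordP i) => [l ->|k ->]; last exact: ireach_zu.
have [j Gj] : exists j, Gzx m A (lshift m l) j != 0.
  apply: contrapT => none.
  have rowl0 : row l (invmx (charF A)) = 0.
    apply/rowP => j; rewrite mxE [RHS]mxE; apply/eqP; apply: contraPT none => Gj.
    by apply; exists j; rewrite /Gzx col_mxEu.
  have /rowP/(_ l) := congr1 (row l) (mulVmx (charF_unit A)).
  by rewrite row_mul rowl0 mul0mx row1 !mxE !eqxx => /eqP; rewrite eq_sym oner_eq0.
by have [/ireach_edge|] := edge _ _ Gj; first apply.
Qed.

Unset Implicit Arguments.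

Theorem theorem1 (R : realType) (n m : nat) (A : 'M[R]_n) (B : 'M[R]_(n, m))
  (PA : pattern n n) (PB : pattern n m) :
  let S1 := exists (dA : 'M[R]_n) (dB : 'M[R]_(n, m)),
              fits PA dA /\ fits PB dB /\ controllable (A + dA) (B + dB) in
  let S2 := (forall l : R[i], spectrum A l -> pencil_maxrank_is A B PA PB l n) /\
            (forall (i : 'I_(n + m)) (j : 'I_n), Gzx m A i j != 0 ->
               input_reachable A B PA PB (vx m j) \/ input_reachable A B PA PB (vz i)) in
  let S3 := (forall l : R[i], spectrum A l ->
               matroid_inter_card (indep_num (W1_mx A B l)) (indep_pat R (W2_pat PA PB)) n) /\
            (forall i : 'I_(n + m), input_reachable A B PA PB (vz i)) in
  (S1 <-> S2) /\ (S2 <-> S3).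
Proof.
move=> S1 S2 S3; split; split.
- move=> [dA [dB [fA [fB ctrl]]]]; split=> [l _|].
    split; last by move=> *; apply: rank_leq_row.
    by exists dA, dB; split=> //; split=> //; apply/eqP; move/hautus: ctrl; apply.
  by apply/edges_zreach; apply: controllable_ireach fA fB ctrl.
- move=> [maxr /edges_zreach zr]; apply: controllable_suff zr => l /maxr.
  by move/pencil_maxrankP.
- move=> [maxr /edges_zreach zr]; split=> // l /maxr.
  by move/pencil_maxrankP/pencil_matched/matroid_matched.
move=> [inter zr]; split=> [l /inter|]; last exact/edges_zreach.
by move/matroid_matched/pencil_matched/pencil_maxrankP.
Qed.
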